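(* Let $d\ge 1$ and let $\mathcal{K}$ be a family of non-degenerate, simple, convex $d$-dimensional polytopes in $\mathbb{R}^d$. Consider the following conditions on $\mathcal{K}$, where for each $K\in\mathcal{K}$ the sets $V,F$ and the quantities $h_*,h_K,w_K,\rho_K$ are those of $K$: (H1) there is a constant $C_*>0$ such that $h_*\ge C_*h_K$ for all $K\in\mathcal{K}$; (H2) there is a constant $D_*>0$ such that $|\boldsymbol{u}-\boldsymbol{v}|\ge D_*h_K$ for all $K\in\mathcal{K}$ and all $\boldsymbol{u},\boldsymbol{v}\in V$ with $\boldsymbol{u}\ne\boldsymbol{v}$; (H3) there is a positive integer $N_V^*$ such that $|V|\le N_V^*$ for all $K\in\mathcal{K}$; (H4) there is a positive integer $N_F^*$ such that $|F|\le N_F^*$ for all $K\in\mathcal{K}$; (H5) there is a constant $C>0$ such that $C h_K\le w_K$ for all $K\in\mathcal{K}$; (H5') there is a constant $\gamma^*>0$ such that $h_K/\rho_K\le\gamma^*$ for all $K\in\mathcal{K}$. Then (H1) $\Rightarrow$ (H2) $\Rightarrow$ (H3) $\Leftrightarrow$ (H4), and (H1) $\Rightarrow$ (H5) $\Leftrightarrow$ (H5').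
   Context: A $d$-dimensional convex polytope $K\subset\mathbb{R}^d$ is the convex hull of finitely many points whose affine hull is $\mathbb{R}^d$. Faces are intersections of $K$ with supporting hyperplanes; vertices are the $0$-dimensional faces and facets the $(d-1)$-dimensional faces. $V$ and $F$ are the sets of vertices and facets; $|V|,|F|$ denote cardinalities, while $|\boldsymbol{u}-\boldsymbol{v}|$ is Euclidean length. For $f\in F$, $V_f$ is the set of vertices contained in $f$. Non-degenerate: adjacent facets do not lie in the same hyperplane. Simple: every vertex lies in exactly $d$ facets. $h_K$ is the diameter of $K$; $h_f(\boldsymbol{x})$ is the distance from $\boldsymbol{x}\in K$ to the hyperplane containing the facet $f$; $h_*=\min_{f\in F}\min_{\boldsymbol{v}\in V\setminus V_f}h_f(\boldsymbol{v})$; $\rho_K$ is the radius of the largest ball inscribed in $K$; $w_K$ is the width of $K$, i.e. the minimal distance between two (distinct) parallel supporting hyperplanes of $K$. *)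

(* Defs.v *)
From HB Require Import structures.
From mathcomp Require Import all_boot all_order all_algebra.
From mathcomp Require Import classical_sets cardinality reals.

Set Implicit Arguments.
Unset Strict Implicit.
Unset Printing Implicit Defensive.

Import Order.TTheory GRing.Theory Num.Theory.

Local Open Scope classical_set_scope.
Local Open Scope card_scope.
Local Open Scope ring_scope.

Section EuclideanSpace.
Context {R : realType} {d : nat}.
Implicit Types (x y a : 'rV[R]_d) (b : R) (A B H : set 'rV[R]_d).

Definition dotv x y : R := \sum_i x 0 i * y 0 i.

(* The norm that MathComp-Analysis puts on 'rV[R]_d is the sup norm. *)
Definition enorm x : R := Num.sqrt (dotv x x).

Definition dist_pt_set x A : R := inf [set enorm (x - y) | y in A].

Definition dist_sets A B : R := inf [set enorm (x - y) | x in A & y in B].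

Definition eball x (r : R) : set 'rV[R]_d := [set y | enorm (y - x) <= r].

Definition conv_hull A : set 'rV[R]_d :=
  [set x | exists n (p : 'I_n -> 'rV[R]_d) (w : 'I_n -> R),
    [/\ forall i, A (p i), forall i, 0 <= w i, \sum_i w i = 1
      & x = \sum_i w i *: p i]].

Definition aff_hull A : set 'rV[R]_d :=
  [set x | exists n (p : 'I_n -> 'rV[R]_d) (w : 'I_n -> R),
    [/\ forall i, A (p i), \sum_i w i = 1 & x = \sum_i w i *: p i]].

(* [A] is nonempty and its affine hull is a translate of a [k]-dimensional
   linear subspace; the empty set has no dimension. *)
Definition has_affdim A (k : nat) : Prop :=
  exists (x0 : 'rV[R]_d) (L : {vspace 'rV[R]_d}),
    aff_hull A = [set x | x - x0 \in L] /\ \dim L = k.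

Definition level_set a b : set 'rV[R]_d := [set x | dotv a x = b].

Definition hyperplane H : Prop := exists a b, a != 0 /\ H = level_set a b.

Definition parallel H1 H2 : Prop :=
  exists a b1 b2, [/\ a != 0, H1 = level_set a b1 & H2 = level_set a b2].

End EuclideanSpace.

Section Polytopes.
Context {R : realType} {d : nat}.
Implicit Types (K G H f g : set 'rV[R]_d) (v x : 'rV[R]_d).

Definition convex_polytope K : Prop :=
  (exists s : seq 'rV[R]_d, K = conv_hull [set` s]) /\ aff_hull K = setT.

Definition supporting_hyperplane K H : Prop :=
  exists a b, [/\ a != 0, H = level_set a b,
    forall x, K x -> dotv a x <= b & K `&` H !=set0].

Definition face K G : Prop :=
  exists H, supporting_hyperplane K H /\ G = K `&` H.

Definition vertices K : set 'rV[R]_d :=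
  [set v | face K [set v] /\ has_affdim [set v] 0].

Definition facets K : set (set 'rV[R]_d) :=
  [set f | face K f /\ has_affdim f d.-1].

(* Distinct facets that share a face of dimension [d - 2]; there are none
   when [d = 1]. *)
Definition adjacent_facets K f g : Prop :=
  [/\ facets K f, facets K g, f <> g
    & exists k, k.+2 = d /\ has_affdim (f `&` g) k].

Definition nondegenerate_polytope K : Prop :=
  forall f g, adjacent_facets K f g ->
    ~ exists H, [/\ hyperplane H, f `<=` H & g `<=` H].

Definition simple_polytope K : Prop :=
  forall v, vertices K v -> [set f | facets K f /\ f v] #= `I_d.

Definition diameter K : R := sup [set enorm (x - y) | x in K & y in K].

(* The hyperplane containing a facet is the facet's affine hull. *)
Definition facet_dist f x : R := dist_pt_set x (aff_hull f).

(* A minimum over finitely many pairs [(f, v)]. *)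
Definition hstar K : R :=
  inf [set r | exists f v,
    [/\ facets K f, vertices K v, ~ f v & r = facet_dist f v]].

Definition inradius K : R :=
  sup [set r : R | 0 < r /\ exists c, eball c r `<=` K].

Definition width K : R :=
  inf [set r | exists H1 H2,
    [/\ supporting_hyperplane K H1, supporting_hyperplane K H2,
        H1 <> H2, parallel H1 H2 & r = dist_sets H1 H2]].

End Polytopes.

Section Families.
Context {R : realType} {d : nat}.
Implicit Types calK : set (set 'rV[R]_d).

Definition condH1 calK : Prop :=
  exists C : R, 0 < C /\ forall K, calK K -> C * diameter K <= hstar K.

Definition condH2 calK : Prop :=
  exists D : R, 0 < D /\ forall K, calK K ->
    forall u v, vertices K u -> vertices K v -> u <> v ->
      D * diameter K <= enorm (u - v).

Definition condH3 calK : Prop :=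
  exists N : nat, (0 < N)%N /\ forall K, calK K -> vertices K #<= `I_N.

Definition condH4 calK : Prop :=
  exists N : nat, (0 < N)%N /\ forall K, calK K -> facets K #<= `I_N.

Definition condH5 calK : Prop :=
  exists C : R, 0 < C /\ forall K, calK K -> C * diameter K <= width K.

Definition condH5' calK : Prop :=
  exists gamma : R, 0 < gamma /\
    forall K, calK K -> diameter K / inradius K <= gamma.

End Families.

(* Main.v *)
(* Pushing a valid inequality (Farkas' lemma) to a basic solution, without
   loosening its tight constraints, shows that a polytope K is cut out by its
   facets, and that distinct vertices are separated by a facet through the
   first one. Hence h_* bounds the distances between vertices from below, and
   vertices and facets determine each other through incidence, so that their
   numbers bound each other (by 2^n); the number of vertices with separated
   positions is bounded by a pigeonhole argument on a grid. If there are at most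
   N vertices, their centroid is at distance at least h_* / N from all facets,
   which bounds the width from below. Finally 2 rho_K <= w_K, since a strip
   containing K contains its inscribed balls, and conversely
   w_K <= 2 d (d + 1) rho_K: in a simplex of maximal volume with vertices in K
   (one of them fixed), the barycentric coordinates of the other vertices
   take values in [-1, 1] on K, so their gradients have norm at most 2 / w_K, and
   the simplex contains a ball of radius w_K / (2 d (d + 1)) about its
   centroid. *)
From HB Require Import structures.
Require Import Defs.
From mathcomp Require Import all_boot all_order all_algebra.
From mathcomp Require Import boolp classical_sets functions cardinality reals.
From mathcomp Require Import ring lra.

Set Implicit Arguments.
Unset Strict Implicit.
Unset Printing Implicit Defensive.

Import Order.TTheory GRing.Theory Num.Theory.

Local Open Scope ring_scope.
Local Open Scope classical_set_scope.
Local Open Scope card_scope.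

(** * Inner product and Euclidean norm on row vectors *)

Section DotProduct.
Context {R : realType} {d : nat}.
Implicit Types (x y a : 'rV[R]_d) (b r : R).

Lemma dotvC x y : dotv x y = dotv y x.
Proof. by apply: eq_bigr => i _; rewrite mulrC. Qed.

Lemma dotv_is_linear a : linear_for *%R (dotv a).
Proof.
move=> k x y; rewrite /dotv mulr_sumr -big_split; apply: eq_bigr => i _.
by rewrite !mxE mulrDr mulrCA.
Qed.

HB.instance Definition _ a :=
  GRing.isLinear.Build R 'rV[R]_d R *%R (dotv a) (dotv_is_linear a).

Lemma dotvDr a x y : dotv a (x + y) = dotv a x + dotv a y.
Proof. exact: raddfD. Qed.

Lemma dotvBr a x y : dotv a (x - y) = dotv a x - dotv a y.
Proof. exact: raddfB. Qed.

Lemma dotvNr a x : dotv a (- x) = - dotv a x.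
Proof. exact: raddfN. Qed.

Lemma dotvZr a b x : dotv a (b *: x) = b * dotv a x.
Proof. exact: linearZ. Qed.

Lemma dotv0r a : dotv a 0 = 0.
Proof. exact: raddf0. Qed.

Lemma dotv_sumr a (I : finType) (P : pred I) (F : I -> 'rV[R]_d) :
  dotv a (\sum_(i | P i) F i) = \sum_(i | P i) dotv a (F i).
Proof. exact: raddf_sum. Qed.

Lemma dotvDl a x y : dotv (x + y) a = dotv x a + dotv y a.
Proof. by rewrite !(dotvC _ a) dotvDr. Qed.

Lemma dotvBl a x y : dotv (x - y) a = dotv x a - dotv y a.
Proof. by rewrite !(dotvC _ a) dotvBr. Qed.

Lemma dotvNl a x : dotv (- x) a = - dotv x a.
Proof. by rewrite !(dotvC _ a) dotvNr. Qed.

Lemma dotvZl a b x : dotv (b *: x) a = b * dotv x a.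
Proof. by rewrite !(dotvC _ a) dotvZr. Qed.

Lemma dotv0l a : dotv 0 a = 0.
Proof. by rewrite dotvC dotv0r. Qed.

Lemma dotv_sum_comb a n (w : 'I_n -> R) (p : 'I_n -> 'rV[R]_d) :
  dotv a (\sum_i w i *: p i) = \sum_i w i * dotv a (p i).
Proof. by rewrite dotv_sumr; apply: eq_bigr => i _; rewrite dotvZr. Qed.

Lemma dotv_mulmx x y : dotv x y = (x *m y^T) 0 0.
Proof. by rewrite mxE; apply: eq_bigr => i _; rewrite mxE. Qed.

Lemma dotvv_ge0 x : 0 <= dotv x x.
Proof. by apply: sumr_ge0 => i _; rewrite -expr2 sqr_ge0. Qed.

Lemma dotvv_eq0 x : (dotv x x == 0) = (x == 0).
Proof.
apply/eqP/eqP => [/eqP|->]; last exact: dotv0l.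
rewrite psumr_eq0 => [/allP xx0|i _]; last by rewrite -expr2 sqr_ge0.
apply/rowP => i; rewrite mxE.
by have := xx0 i (mem_index_enum i); rewrite /= mulf_eq0 orbb => /eqP.
Qed.

Lemma dotvv_gt0 x : x != 0 -> 0 < dotv x x.
Proof. by rewrite lt_def dotvv_eq0 dotvv_ge0 andbT. Qed.

Lemma enorm_sqr x : enorm x ^+ 2 = dotv x x.
Proof. by rewrite sqr_sqrtr // dotvv_ge0. Qed.

Lemma enorm_ge0 x : 0 <= enorm x.
Proof. exact: sqrtr_ge0. Qed.

Lemma enorm_gt0 x : x != 0 -> 0 < enorm x.
Proof. by move=> x0; rewrite sqrtr_gt0 dotvv_gt0. Qed.

Lemma enorm0 : enorm (0 : 'rV[R]_d) = 0.
Proof. by rewrite /enorm dotv0l sqrtr0. Qed.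

Lemma enormZ b x : enorm (b *: x) = `|b| * enorm x.
Proof.
by rewrite /enorm dotvZl dotvZr mulrA -expr2 sqrtrM ?sqr_ge0 // sqrtr_sqr.
Qed.

Lemma enormN x : enorm (- x) = enorm x.
Proof. by rewrite -scaleN1r enormZ normrN normr1 mul1r. Qed.

Lemma enormB x y : enorm (x - y) = enorm (y - x).
Proof. by rewrite -enormN opprB. Qed.

(** Cauchy-Schwarz: the square of [dotv x x *: y - dotv x y *: x] is [dotv x x] times the difference
    of the squared sides. *)
Lemma dotv_le_enorm x y : dotv x y <= enorm x * enorm y.
Proof.
have [-> | x0] := eqVneq x 0; first by rewrite dotv0l enorm0 mul0r.
apply: le_trans (ler_norm _) _.
rewrite -ler_sqr ?nnegrE ?mulr_ge0 ?enorm_ge0 // real_normK ?num_real //.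
rewrite exprMn !enorm_sqr.
have xx := dotvv_gt0 x0.
have := dotvv_ge0 (dotv x x *: y - dotv x y *: x).
rewrite dotvBl !dotvBr !dotvZl !dotvZr (dotvC y x) => H.
rewrite -(ler_pM2l xx); lra.
Qed.

Lemma enormD x y : enorm (x + y) <= enorm x + enorm y.
Proof.
rewrite -ler_sqr ?nnegrE ?addr_ge0 ?enorm_ge0 //.
rewrite sqrrD !enorm_sqr dotvDl !dotvDr (dotvC y x).
have := dotv_le_enorm x y; lra.
Qed.

Lemma enorm_sum (I : finType) (F : I -> 'rV[R]_d) :
  enorm (\sum_i F i) <= \sum_i enorm (F i).
Proof.
elim/big_ind2: _ => [|x1 b1 x2 b2 h1 h2|//]; first by rewrite enorm0.
by apply: le_trans (enormD _ _) _; apply: lerD.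
Qed.

Lemma dotv_delta x i : dotv (delta_mx 0 i) x = x 0 i.
Proof.
rewrite /dotv (bigD1 i) //= big1 => [|j /negPf ji].
  by rewrite addr0 !mxE !eqxx mul1r.
by rewrite mxE ji andbF mul0r.
Qed.

Lemma enorm_delta i : enorm (delta_mx 0 i : 'rV[R]_d) = 1.
Proof. by rewrite /enorm dotv_delta mxE !eqxx sqrtr1. Qed.

Lemma coord_le_enorm x i : `|x 0 i| <= enorm x.
Proof.
have H y : y 0 i <= enorm y.
  by rewrite -dotv_delta -[leRHS]mul1r -(enorm_delta i) dotv_le_enorm.
by rewrite ler_norml H andbT lerNl; have := H (- x); rewrite mxE enormN.
Qed.

Lemma enorm_le_sum x : enorm x <= \sum_i `|x 0 i|.
Proof.
rewrite {1}(row_sum_delta x); apply: le_trans (enorm_sum _) _.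
by apply: ler_sum => i _; rewrite enormZ enorm_delta mulr1.
Qed.

End DotProduct.

(** * Farkas' lemma, separation from a convex hull, and the vertices of a polytope *)

Section ConvexHull.
Context {R : realType}.

(* Bartl's algebraic proof: when the last form is needed, pick [x] violating
   the conclusion for the other forms and project along [x] onto its kernel. *)
Lemma farkas d n (p : 'I_n -> 'rV[R]_d) (g : 'rV[R]_d) :
  (forall x, (forall i, dotv (p i) x <= 0) -> dotv g x <= 0) ->
  exists w : 'I_n -> R, (forall i, 0 <= w i) /\ g = \sum_i w i *: p i.
Proof.
elim: n p g => [|n IHn] p g pg.
  exists (fun=> 0); split=> //; rewrite big_ord0; apply/eqP; rewrite -dotvv_eq0.
  by rewrite eq_le dotvv_ge0 andbT pg // => -[].
pose q i := p (lift ord0 i); pose p0 := p ord0.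
pose ext w0 (w : 'I_n -> R) i := if unlift ord0 i is Some j then w j else w0.
have extE w0 w : \sum_i ext w0 w i *: p i = w0 *: p0 + \sum_i w i *: q i.
  rewrite big_ord_recl /ext unlift_none; congr (_ + _).
  by apply: eq_bigr => i _; rewrite liftK.
have ext_ge0 w0 w :
    0 <= w0 -> (forall i, 0 <= w i) -> forall i, 0 <= ext w0 w i.
  by move=> w0_ge0 w_ge0 i; rewrite /ext; case: unliftP.
have [qg|] :=
  pselect (forall x, (forall i, dotv (q i) x <= 0) -> dotv g x <= 0).
  have [w [w_ge0 ->]] := IHn _ _ qg.
  exists (ext 0 w); split; first exact: ext_ge0.
  by rewrite extE scale0r add0r.
move=> /existsNP[x /not_implyP[qx /negP]]; rewrite -ltNge => gx.
have p0x : 0 < dotv p0 x.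
  rewrite ltNge; apply/negP => p0x; suff: dotv g x <= 0 by rewrite leNgt gx.
  by apply: pg => i; case: (unliftP ord0 i) => [j|] -> //; apply: qx.
pose proj h := h - (dotv h x / dotv p0 x) *: p0.
have [y qgy|w [w_ge0 wE]] := IHn (proj \o q) (proj g).
  (* [proj] is adjoint to sliding [y] along [x] into the kernel of [dotv p0], so the constraints on
     [y] become constraints at [z], where that of [p0] is tight. *)
  pose z := y - (dotv p0 y / dotv p0 x) *: x.
  have projE h : dotv (proj h) y = dotv h z.
    by rewrite dotvBr dotvBl dotvZl dotvZr; field; rewrite gt_eqF.
  rewrite projE; apply: pg => i; case: (unliftP ord0 i) => [j|] ->.
    by have := qgy j; rewrite /= projE.
  by rewrite -/p0 dotvBr dotvZr divfK ?gt_eqF // subrr.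
(* The weight of [p0] collects what the projections subtract; it is nonnegative because [dotv g x]
   is positive and each [dotv (q i) x] is at most 0. *)
exists (ext (dotv g x / dotv p0 x
             + \sum_i w i * (- (dotv (q i) x / dotv p0 x))) w); split.
  apply: ext_ge0 => //; apply: addr_ge0; first by rewrite divr_ge0 ?ltW.
  apply: sumr_ge0 => i _; rewrite mulr_ge0 // -mulNr divr_ge0 ?oppr_ge0 //.
  exact: ltW.
rewrite extE; move/eqP: wE; rewrite subr_eq => /eqP gE; rewrite [LHS]gE.
rewrite scalerDl -addrA [LHS]addrC; congr (_ + _); rewrite scaler_suml.
rewrite -big_split; apply: eq_bigr => i _ /=.
by rewrite scalerBr scalerA mulrN scaleNr addrC.
Qed.

Lemma dotv_row_mx m n (x1 y1 : 'rV[R]_m) (x2 y2 : 'rV[R]_n) :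
  dotv (row_mx x1 x2) (row_mx y1 y2) = dotv x1 y1 + dotv x2 y2.
Proof.
rewrite /dotv big_split_ord; congr (_ + _); apply: eq_bigr => i _ /=.
  by rewrite !row_mxEl.
by rewrite !row_mxEr.
Qed.

Context {d : nat}.
Implicit Types (A K : set 'rV[R]_d) (x y v a : 'rV[R]_d) (s : seq 'rV[R]_d).

Lemma seq_nthP s y : y \in s -> exists i : 'I_(size s), s`_i = y.
Proof. by move=> /(nthP 0)[i i_lt <-]; exists (Ordinal i_lt). Qed.

Lemma sub_conv_hull A : A `<=` conv_hull A.
Proof.
move=> x Ax; exists 1%N, (fun=> x), (fun=> 1); split=> //.
  by rewrite big_ord1.
by rewrite big_ord1 scale1r.
Qed.

Lemma conv_hull_le A a b : (forall y, A y -> dotv a y <= b) ->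
  forall x, conv_hull A x -> dotv a x <= b.
Proof.
move=> Ab _ [n [p [w [Ap w_ge0 w1 ->]]]]; rewrite dotv_sum_comb.
rewrite -[leRHS]mul1r -w1 mulr_suml; apply: ler_sum => i _.
by rewrite ler_wpM2l // Ab.
Qed.

(** The weighted mean of the nonnegative slacks vanishes, so every point of nonzero weight is tight.
    Weightless points, possibly not tight, are exchanged for a tight one. *)
Lemma conv_hull_face A a b : (forall y, A y -> dotv a y <= b) ->
  conv_hull A `&` level_set a b `<=` conv_hull (A `&` level_set a b).
Proof.
move=> Ab x [[n [p [w [Ap w_ge0 w1 xE]]]] axb].
have tight i : w i != 0 -> dotv a (p i) = b.
  move=> wi0; have /eqP : \sum_i w i * (b - dotv a (p i)) = 0.
    under eq_bigr do rewrite mulrBr.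
    by rewrite sumrB -mulr_suml w1 -dotv_sum_comb -xE axb mul1r subrr.
  rewrite psumr_eq0 => [|j _]; last by rewrite mulr_ge0 // subr_ge0 Ab.
  move=> /allP /(_ i (mem_index_enum i)) /=.
  by rewrite mulf_eq0 (negPf wi0) subr_eq0 => /eqP.
have [i0 wi0] : exists i, w i != 0.
  apply/existsP; rewrite -[X in is_true X]negbK; apply/negP.
  rewrite negb_exists => /forallP w0; move: w1.
  rewrite big1 => [/eqP|i _]; first by rewrite eq_sym oner_eq0.
  by apply/eqP/negPn/w0.
exists n, (fun i => if w i == 0 then p i0 else p i), w; split=> //.
  by move=> i; case: eqVneq => [_|wi]; split; rewrite /level_set /= ?tight.
by rewrite xE; apply: eq_bigr => i _; case: eqVneq => [->|//]; rewrite !scale0r.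
Qed.

(** Farkas' lemma applies once a coordinate 1 is appended to all points: the extra coordinate yields
    the offset [b] in one alternative and weights of sum 1 in the other. *)
Lemma conv_hull_separation s x : ~ conv_hull [set` s] x ->
  exists a b, (forall y, y \in s -> dotv a y <= b) /\ b < dotv a x.
Proof.
move=> sx; apply: contrapT => nsep; apply: sx.
pose lift1 y : 'rV[R]_(d + 1) := row_mx y (const_mx 1).
have [z zs|w [w_ge0]] := @farkas _ (size s) (fun i => lift1 s`_i) (lift1 x).
  have dz y : dotv (lift1 y) z = dotv (lsubmx z) y + z 0 (rshift d 0).
    rewrite -{1}[z]hsubmxK dotv_row_mx dotvC; congr (_ + _).
    by rewrite /dotv big_ord1 !mxE mul1r.
  rewrite leNgt; apply/negP => xz; apply: nsep.
  exists (lsubmx z), (- z 0 (rshift d 0)); split=> [_ /seq_nthP[i <-]|].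
    by have := zs i; rewrite dz; lra.
  by move: xz; rewrite dz; lra.
have -> : \sum_i w i *: lift1 s`_i =
    row_mx (\sum_i w i *: s`_i) (const_mx (\sum_i w i)).
  apply/rowP => j; rewrite summxE; case: (split_ordP j) => k ->.
    by rewrite row_mxEl summxE; apply: eq_bigr => i _; rewrite mxE row_mxEl mxE.
  rewrite row_mxEr mxE; apply: eq_bigr => i _.
  by rewrite mxE row_mxEr mxE mulr1.
move=> /eq_row_mx[xE] /rowP/(_ 0); rewrite !mxE => w1.
exists (size s), (fun i => s`_i), w; split=> // i.
exact: mem_nth.
Qed.

Lemma conv_hull_filter s v : v \in s ->
  conv_hull [set` filter (predC1 v) s] v ->
  conv_hull [set` filter (predC1 v) s] = conv_hull [set` s].
Proof.
move=> vs vconv; apply/seteqP; split=> x.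
  move=> [n [p [w [ps w_ge0 w1 ->]]]]; exists n, p, w; split=> // i.
  by have := ps i; rewrite /= mem_filter => /andP[].
move=> sx; apply: contrapT => /conv_hull_separation[a [b [ab]]].
rewrite ltNge => /negP; apply; apply: conv_hull_le sx => y ys.
have [->|yv] := eqVneq y v; last by apply: ab; rewrite mem_filter /= yv.
by apply: conv_hull_le vconv => z /= zs; apply: ab.
Qed.

Lemma aff_hull_level_set A a b : A `<=` level_set a b ->
  aff_hull A `<=` level_set a b.
Proof.
move=> Ab _ [n [p [w [Ap w1 ->]]]]; rewrite /level_set /= dotv_sum_comb.
rewrite -[RHS]mul1r -w1 mulr_suml; apply: eq_bigr => i _.
by rewrite (Ab _ (Ap i)).
Qed.

Lemma not_sub_level_set A a b : aff_hull A = setT -> a != 0 ->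
  ~ (A `<=` level_set a b).
Proof.
move=> AT a0 /aff_hull_level_set; rewrite AT.
have aa0 : dotv a a != 0 by rewrite dotvv_eq0.
move=> /(_ (((b + 1) / dotv a a) *: a) I).
by rewrite /level_set /= dotvZr divfK //; lra.
Qed.

Lemma has_affdim_point v : has_affdim [set v] 0.
Proof.
exists v, 0%VS; split; last exact: dimv0.
apply/seteqP; split=> x /=; rewrite memv0 subr_eq0.
  move=> [n [p [w [pv w1 ->]]]]; apply/eqP.
  by rewrite -[RHS]scale1r -w1 scaler_suml; apply: eq_bigr => i _; rewrite pv.
move=> /eqP->; exists 1%N, (fun=> v), (fun=> 1); split=> //.
  by rewrite big_ord1.
by rewrite big_ord1 scale1r.
Qed.

Lemma exists_nonzero_vector : (0 < d)%N -> exists a, a != 0.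
Proof.
case: d => // d' _; exists (const_mx 1); apply/eqP => /rowP/(_ 0).
by rewrite !mxE => /eqP; rewrite oner_eq0.
Qed.

(** A generating list of minimal length works: each member is separated from the hull of the others,
    since it could otherwise be dropped, and the separating form exposes it. Conversely, the face
    consisting of a vertex is the hull of the generators on it, so the vertex is a generator. *)
Lemma polytope_vertices K : (0 < d)%N -> convex_polytope K ->
  exists s, [/\ uniq s, K = conv_hull [set` s] & vertices K = [set` s]].
Proof.
move=> d_gt0 [genK KT].
have : exists n, `[< exists s, size s = n /\ K = conv_hull [set` s] >].
  by have [s sK] := genK; exists (size s); apply/asboolP; exists s.
move=> /ex_minnP[_ /asboolP[s [<- KE]] min_s]; exists s.
have {}min_s t : K = conv_hull [set` t] -> (size s <= size t)%N.
  by move=> KEt; apply: min_s; apply/asboolP; exists t.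
have uniq_s : uniq s.
  rewrite -[uniq s]negbK -ltn_size_undup -leqNgt min_s // KE.
  by congr conv_hull; apply/seteqP; split=> x /=; rewrite mem_undup.
split=> //; apply/seteqP; split=> v.
  move=> [[_ [[a [b [a0 -> Kab _]]] vE]] _].
  have sab y : [set` s] y -> dotv a y <= b.
    by move=> sy; apply: Kab; rewrite KE; apply: sub_conv_hull.
  have : (K `&` level_set a b) v by rewrite -vE.
  rewrite {1}KE => /(conv_hull_face sab) [n [p [w [ps _ w1 _]]]].
  case: n p w ps w1 => [|n] p w ps w1.
    by move/eqP: w1; rewrite big_ord0 eq_sym oner_eq0.
  have [sp ap] := ps ord0; have : [set v] (p ord0).
    by rewrite vE; split=> //; rewrite KE; apply: sub_conv_hull.
  by move=> /= <-.
move=> /= vs; split; last exact: has_affdim_point.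
have : ~ conv_hull [set` filter (predC1 v) s] v.
  move=> /(conv_hull_filter vs) sE; have := min_s (filter (predC1 v) s).
  rewrite sE KE => /(_ erefl); apply/negP; rewrite -ltnNge size_filter.
  rewrite -(count_predC (pred1 v) s) -[ltnLHS]add0n ltn_add2r.
  by rewrite -has_count has_pred1.
move=> /conv_hull_separation[a [b [ab bv]]].
have {}ab y : y \in s -> y != v -> dotv a y <= b.
  by move=> ys yv; apply: ab; rewrite mem_filter /= yv.
have sv y : [set` s] y -> dotv a y <= dotv a v.
  move=> /= ys; have [-> //|yv] := eqVneq y v.
  by apply: le_trans (ltW bv); apply: ab.
have slevel : [set` s] `&` level_set a (dotv a v) `<=` [set v].
  move=> y [ys ay] /=; apply: contrapT => /eqP yv.
  by have := ab y ys yv; rewrite ay leNgt bv.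
have KE' : [set v] = K `&` level_set a (dotv a v).
  apply/seteqP; split=> [_ ->|x]; rewrite KE.
    by split=> //; apply: sub_conv_hull.
  move=> /(conv_hull_face sv)[n [p [w [ps _ w1 ->]]]] /=.
  rewrite -[RHS]scale1r -w1 scaler_suml; apply: eq_bigr => i _.
  by rewrite (slevel _ (ps i)).
exists (level_set a (dotv a v)); split=> //.
exists a, (dotv a v); split=> //; last by exists v; rewrite -KE'.
  (* Were [a] zero, [K] would be the single point [v], whose affine hull is not the whole space as
     [d] is positive. *)
  apply/eqP => a0; have [c c0] := exists_nonzero_vector d_gt0.
  apply: (@not_sub_level_set K c (dotv c v) KT c0) => x Kx.
  suff <- : v = x by [].
  symmetry; suff: [set v] x by [].
  by rewrite KE'; split=> //; rewrite /level_set /= a0 !dotv0l.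
by move=> x; rewrite KE; apply: conv_hull_le.
Qed.

End ConvexHull.

(** * Facets obtained from basic solutions of linear inequalities *)

Section Facets.
Context {R : realType} {d : nat}.
Implicit Types (A K f g : set 'rV[R]_d) (x y v a q : 'rV[R]_d).
Implicit Types (s : seq 'rV[R]_d).

Lemma not_row_full_orthogonal n (X : 'M[R]_(n, d)) : ~~ row_full X ->
  exists2 q, q != 0 & forall i, dotv q (row i X) = 0.
Proof.
move=> Xnfull; have /rowV0Pn[q /submxP[w qE] q0] : (cokermx X)^T != 0.
  rewrite -mxrank_eq0 mxrank_tr mxrank_coker subn_eq0 -ltnNge ltn_neqAle.
  by rewrite rank_leq_col andbT.
exists q => // i; rewrite dotvC dotv_mulmx -row_mul qE trmx_mul trmxK mulmxA.
by rewrite mulmx_coker mul0mx !mxE.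
Qed.

(* Moving [a] along a direction orthogonal to the tight [p i], until another
   constraint becomes tight, keeps [1 < dotv a x] if the direction is chosen
   to form a non-obtuse angle with [x]. *)
Lemma basic_solution n (p : 'I_n -> 'rV[R]_d) x a0 :
    (forall q, q != 0 -> exists i, 0 < dotv q (p i)) ->
    (forall i, dotv a0 (p i) <= 1) -> 1 < dotv a0 x ->
  exists a, [/\ forall i, dotv a (p i) <= 1, 1 < dotv a x,
    forall i, dotv a0 (p i) = 1 -> dotv a (p i) = 1
    & row_full (\matrix_i (if dotv a (p i) == 1 then p i else 0))].
Proof.
move=> p_pos.
have [m] := ubnP #|[pred i | dotv a0 (p i) != 1]|.
elim: m a0 => // m IHm a0 card_a0 a0p a0x.
(* Zero rows stand for the constraints that are not tight, so [row_full Y] says that the tight [p i]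
   span the space. *)
set Y := (\matrix_i (if dotv a0 (p i) == 1 then p i else 0) : 'M_(n, d)).
have [Yfull|Ynfull] := boolP (row_full Y); first by exists a0.
have [q [q0 qx qtight]] : exists q, [/\ q != 0, 0 <= dotv q x
    & forall i, dotv a0 (p i) = 1 -> dotv q (p i) = 0].
  have [q q0 qtight] : exists2 q, q != 0
      & forall i, dotv a0 (p i) = 1 -> dotv q (p i) = 0.
    have [q q0 Yq] := not_row_full_orthogonal Ynfull.
    exists q => // i ai.
    by have := Yq i; rewrite /Y rowK ai eqxx.
  have [qx|/ltW qx] := leP 0 (dotv q x); first by exists q.
  exists (- q); split; rewrite ?oppr_eq0 // ?dotvNl ?oppr_ge0 //.
  by move=> i /qtight qi; rewrite dotvNl qi oppr0.
have [i0 qi0] := p_pos q q0.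
(* This is the step length along [q] at which constraint [i] becomes tight; the smallest one is
   taken, and [p_pos] ensures that there is one. *)
pose slack i := (1 - dotv a0 (p i)) / dotv q (p i).
case: (@Order.TotalTheory.arg_minP
         _ _ _ i0 [pred i | 0 < dotv q (p i)] slack qi0).
move=> i1 /= qi1 min_slack; set t := slack i1 in min_slack.
have t_ge0 : 0 <= t by rewrite divr_ge0 ?subr_ge0 ?a0p // ltW.
have tight i : dotv a0 (p i) = 1 -> dotv (a0 + t *: q) (p i) = 1.
  by move=> ai; rewrite dotvDl dotvZl ai qtight // mulr0 addr0.
have ti1 : dotv (a0 + t *: q) (p i1) = 1.
  by rewrite dotvDl dotvZl divfK ?gt_eqF // addrC subrK.
have [|i||a [ap ax atight afull]] := IHm (a0 + t *: q).
- rewrite -ltnS; apply: leq_trans card_a0; rewrite ltnS.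
  apply/proper_card/properP; split.
    by apply/fintype.subsetP => i; rewrite !inE; apply: contraNneq => /tight->.
  exists i1; rewrite !inE ?ti1 ?eqxx //; apply/eqP => /qtight qi1_0.
  by move: qi1; rewrite qi1_0 ltxx.
- rewrite dotvDl dotvZl -lerBrDl.
  have [qi|qi] := ltP 0 (dotv q (p i)).
    by rewrite -ler_pdivlMr // min_slack.
  by apply: le_trans (mulr_ge0_le0 t_ge0 qi) _; rewrite subr_ge0.
- by rewrite dotvDl dotvZl; apply: ltr_wpDr => //; apply: mulr_ge0.
by exists a; split=> // i /tight; apply: atight.
Qed.

Lemma aff_hull_nonempty A x : aff_hull A x -> A !=set0.
Proof.
move=> [[|n] [p [w [Ap w1 _]]]]; last by exists (p ord0).
by move/eqP: w1; rewrite big_ord0 eq_sym oner_eq0.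
Qed.

(** The direction space is the kernel of [dotv a], taken as a linear map [h] onto the
    one-dimensional space, and rank-nullity gives its dimension. *)
Lemma has_affdim_level_set A a b : a != 0 -> aff_hull A = level_set a b ->
  has_affdim A d.-1.
Proof.
move=> a0 AE; pose h : 'Hom('rV[R]_d, 'rV[R]_1) := linfun (mulmxr a^T).
have hE x : h x = (dotv a x)%:M.
  by rewrite lfunE /= dotvC dotv_mulmx -mx11_scalar.
have aa := dotvv_gt0 a0.
exists ((b / dotv a a) *: a), (lker h); split.
  rewrite AE; apply/seteqP; split=> x; rewrite /level_set /= memv_ker hE dotvBr.
    by move=> ->; rewrite dotvZr divfK ?gt_eqF // subrr raddf0.
  rewrite dotvZr divfK ?gt_eqF // => /eqP/matrixP/(_ 0 0).
  by rewrite !mxE eqxx mulr1n => /eqP; rewrite subr_eq0 => /eqP.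
have := limg_ker_dim h fullv; rewrite capfv dimvf /dim /= mul1n => dimE.
suff h1 : \dim (h @: fullv) = 1%N.
  by move: dimE; rewrite h1 addn1 => /(congr1 predn).
apply/eqP; rewrite eqn_leq; apply/andP; split.
  by apply: leq_trans (dimvS (subvf _)) _; rewrite dimvf /dim /=.
rewrite lt0n dimv_eq0; apply/eqP => h0.
have : h a \in (h @: fullv)%VS by apply: memv_img; apply: memvf.
rewrite h0 memv0 hE => /eqP/matrixP/(_ 0 0).
by rewrite !mxE eqxx mulr1n => /eqP; rewrite gt_eqF.
Qed.

(** An outer normal and offset of a facet. The last clause, that the facet spans its hyperplane,
    relates the distance to its affine hull to the slack [b - dotv a x]. *)
Definition facet_normal K a (b : R) : Prop :=
  [/\ a != 0, forall y, K y -> dotv a y <= b, facets K (K `&` level_set a b)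
    & level_set a b `<=` aff_hull (K `&` level_set a b)].

Lemma facet_normalP K a b : a != 0 -> (forall y, K y -> dotv a y <= b) ->
  level_set a b `<=` aff_hull (K `&` level_set a b) -> facet_normal K a b.
Proof.
move=> a0 Kab affL.
have affE : aff_hull (K `&` level_set a b) = level_set a b.
  by apply/seteqP; split=> //; apply: aff_hull_level_set => x [].
split=> //; split; last exact: has_affdim_level_set affE.
exists (level_set a b); split=> //; exists a, b; split=> //.
apply: (@aff_hull_nonempty _ ((b / dotv a a) *: a)); apply: affL.
by rewrite /level_set /= dotvZr divfK // dotvv_eq0.
Qed.

Lemma sub_conv_aff_hull A : conv_hull A `<=` aff_hull A.
Proof. by move=> x [n [p [w [Ap _ w1 xE]]]]; exists n, p, w. Qed.

Lemma conv_hull_not_sub_level_set A a b :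
  aff_hull (conv_hull A) = setT -> a != 0 -> ~ (A `<=` level_set a b).
Proof.
move=> AT a0 Ab; apply: (not_sub_level_set AT a0) => x.
by move=> /sub_conv_aff_hull; apply: (aff_hull_level_set Ab).
Qed.

Definition centroid s : 'rV[R]_d := (size s)%:R^-1 *: \sum_(i < size s) s`_i.

Lemma sum_centroidB s : \sum_(i < size s) (s`_i - centroid s) = 0.
Proof.
rewrite sumrB sumr_const card_ord /centroid.
case: s => [|y s]; first by rewrite big_ord0 mulr0n subr0.
by rewrite -scaler_nat scalerA mulfV ?pnatr_eq0 // scale1r subrr.
Qed.

(** The values of [q] on the generators, measured from the centroid, sum to zero: if none were
    positive, all would vanish and the generators would lie in a hyperplane. *)
Lemma centroid_interior s q : aff_hull (conv_hull [set` s]) = setT -> q != 0 ->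
  exists i : 'I_(size s), 0 < dotv q (s`_i - centroid s).
Proof.
move=> sT q0; apply: contrapT => qs.
apply: (conv_hull_not_sub_level_set (b := dotv q (centroid s)) sT q0).
move=> _ /seq_nthP[i <-].
have q_ge0 (j : 'I_(size s)) : 0 <= - dotv q (s`_j - centroid s).
  by rewrite oppr_ge0 leNgt; apply/negP => qj; apply: qs; exists j.
have : \sum_(i < size s) - dotv q (s`_i - centroid s) == 0.
  by rewrite sumrN -dotv_sumr sum_centroidB dotv0r oppr0.
rewrite psumr_eq0 // => /allP /(_ i (mem_index_enum _)) /=.
by rewrite oppr_eq0 dotvBr subr_eq0 => /eqP.
Qed.

(** With the centroid as origin the inequality can be scaled to right-hand side 1, and
    [basic_solution] replaces it by one whose tight generators span the space linearly. They then
    span its hyperplane affinely, so the new inequality defines a facet. *)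
Lemma facet_beyond K s a0 b0 x : aff_hull K = setT ->
    K = conv_hull [set` s] ->
    (forall y, y \in s -> dotv a0 y <= b0) -> b0 < dotv a0 x ->
  exists a b, [/\ facet_normal K a b, b < dotv a x
    & forall y, y \in s -> dotv a0 y = b0 -> dotv a y = b].
Proof.
move=> KT KE sab b0x; set c := centroid s.
have sT : aff_hull (conv_hull [set` s]) = setT by rewrite -KE.
have a0_neq0 : a0 != 0.
  apply/eqP => a00; move: b0x sab; rewrite a00 dotv0l => b0_lt0 sab.
  have /aff_hull_nonempty[z] : aff_hull K 0 by rewrite KT.
  rewrite KE => /sub_conv_aff_hull/aff_hull_nonempty[y /sab].
  by rewrite dotv0l leNgt b0_lt0.
have [i ci] := centroid_interior sT a0_neq0.
have beta_gt0 : 0 < b0 - dotv a0 c.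
  by move: ci (sab _ (mem_nth 0 (ltn_ord i))); rewrite dotvBr -/c; lra.
pose p (i : 'I_(size s)) := s`_i - c.
have divE y : dotv ((b0 - dotv a0 c)^-1 *: a0) (y - c) =
    (dotv a0 y - dotv a0 c) / (b0 - dotv a0 c).
  by rewrite dotvZl dotvBr mulrC.
have [q q0|||a [ap ax atight afull]] :=
  @basic_solution _ p (x - c) ((b0 - dotv a0 c)^-1 *: a0).
- exact: centroid_interior.
- move=> j; rewrite divE ler_pdivrMr // mul1r lerD2r.
  by apply: sab; apply: mem_nth.
- by rewrite divE ltr_pdivlMr // mul1r ltrD2r.
exists a, (1 + dotv a c).
have sa y : y \in s -> dotv a y <= 1 + dotv a c.
  by move=> /seq_nthP[j <-]; have := ap j; rewrite dotvBr lerBlDr.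
split; last 1 first.
- move=> _ /seq_nthP[j <-] aj; have := atight j.
  rewrite divE aj divff ?gt_eqF // dotvBr.
  by move=> /(_ erefl) /eqP; rewrite subr_eq => /eqP.
- apply: facet_normalP.
  + by apply/eqP => a_0; move: ax; rewrite a_0 dotv0l ltNge ler01.
  + by rewrite KE; apply: conv_hull_le.
  (* Applying [a] to an expansion of [z - c] in the tight [p i] shows that its coefficients sum to
     1, so [z] is an affine combination of tight generators. *)
  move=> z az; have az1 : dotv a (z - c) = 1.
    by rewrite dotvBr az addrK.
  have /submxP[u] := submx_full (z - c) afull.
  pose tight i := dotv a (p i) == 1.
  rewrite mulmx_sum_row => zE.
  pose w i := if tight i then u 0 i else 0.
  have {}zE : z - c = \sum_i w i *: p i.
    rewrite zE; apply: eq_bigr => j _; rewrite rowK /w -/(tight j).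
    by case: (tight j); rewrite ?scaler0 ?scale0r.
  have w1 : \sum_i w i = 1.
    rewrite -az1 zE dotv_sum_comb; apply: eq_bigr => j _; rewrite /w.
    by case: ifP => [/eqP->|]; rewrite ?mulr1 ?mul0r.
  have [i0 tight_i0] : exists i, tight i.
    apply/existsP; rewrite -[X in is_true X]negbK; apply/negP.
    rewrite negb_exists => /forallP ntight; move/eqP: w1.
    by rewrite big1 1?eq_sym ?oner_eq0 // => j _; rewrite /w (negPf (ntight j)).
  exists (size s), (fun j => if tight j then s`_j else s`_i0), w; split=> //.
    move=> j; have Ks (k : 'I_(size s)) :
        tight k -> (K `&` level_set a (1 + dotv a c)) s`_k.
      move=> /eqP; rewrite dotvBr => /eqP; rewrite subr_eq => /eqP ak.
      split=> //.
      by rewrite KE; apply: sub_conv_hull; apply: mem_nth.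
    by case: ifP => [/Ks//|_]; apply: Ks.
  transitivity (\sum_i w i *: p i + \sum_i w i *: c).
    by rewrite -zE -scaler_suml w1 scale1r subrK.
  rewrite -big_split; apply: eq_bigr => j _ /=; rewrite -scalerDr subrK /w.
  by case: ifP; rewrite ?scale0r.
- by move: ax; rewrite dotvBr; lra.
Qed.

End Facets.

(** * Diameter, width and inscribed balls *)

Section Sizes.
Context {R : realType} {d : nat}.
Implicit Types (A B K f g H : set 'rV[R]_d) (x y v a q u : 'rV[R]_d).
Implicit Types (s : seq 'rV[R]_d).

Lemma convex_polytope_nonempty K : convex_polytope K -> K !=set0.
Proof. by move=> [_ KT]; apply: (@aff_hull_nonempty _ _ K 0); rewrite KT. Qed.

Lemma polytope_bounded K : convex_polytope K ->
  exists M, forall x, K x -> enorm x <= M.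
Proof.
move=> [[s ->] _]; exists (\sum_(i < size s) enorm s`_i).
move=> _ [n [p [w [ps w_ge0 w1 ->]]]].
apply: le_trans (enorm_sum _) _; rewrite -[leRHS]mul1r -w1 mulr_suml.
apply: ler_sum => i _; rewrite enormZ ger0_norm // ler_wpM2l //.
have [k <-] := seq_nthP (ps i); rewrite (bigD1 k) //= lerDl.
by apply: sumr_ge0 => j _; apply: enorm_ge0.
Qed.

Lemma enorm_le_diameter K x y : convex_polytope K -> K x -> K y ->
  enorm (x - y) <= diameter K.
Proof.
move=> /polytope_bounded[M KM] Kx Ky; apply: ub_le_sup; last first.
  by exists x => //; exists y.
exists (M + M) => _ [x1 Kx1 [y1 Ky1 <-]].
by apply: le_trans (enormD _ _) _; rewrite enormN lerD // KM.
Qed.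

Lemma diameter_ge0 K : convex_polytope K -> 0 <= diameter K.
Proof.
move=> polK; have [x Kx] := convex_polytope_nonempty polK.
by have := enorm_le_diameter polK Kx Kx; rewrite subrr enorm0.
Qed.

Lemma inf_nonneg (E : set R) : (forall r, E r -> 0 <= r) -> 0 <= inf E.
Proof.
move=> E_ge0; have [[r Er]|/set0P/negP/negPn/eqP ->] := pselect (E !=set0).
  by apply: lb_le_inf => //; exists r.
by rewrite inf0.
Qed.

Lemma dist_pt_set_le A x y : A y -> dist_pt_set x A <= enorm (x - y).
Proof.
move=> Ay; apply: ge_inf; last by exists y.
by exists 0 => _ [z _ <-]; apply: enorm_ge0.
Qed.

Lemma dist_sets_ge0 A B : 0 <= dist_sets A B.
Proof. by apply: inf_nonneg => _ [x _ [y _ <-]]; apply: enorm_ge0. Qed.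

Lemma dist_sets_le A B x y : A x -> B y -> dist_sets A B <= enorm (x - y).
Proof.
move=> Ax By; apply: ge_inf; last by exists x => //; exists y.
by exists 0 => _ [x1 _ [y1 _ <-]]; apply: enorm_ge0.
Qed.

Lemma level_setN a b : level_set (- a) (- b) = level_set a b.
Proof.
apply/seteqP; split=> x; rewrite /level_set /= dotvNl; first exact: oppr_inj.
by move=> ->.
Qed.

(** A linear form attains its extreme values on [K] at generators, and they differ because [K] lies
    in no hyperplane. *)
Lemma parallel_support K a : convex_polytope K -> a != 0 ->
  exists x y, [/\ K x, K y, dotv a y < dotv a x,
    supporting_hyperplane K (level_set a (dotv a x))
    & supporting_hyperplane K (level_set a (dotv a y))].
Proof.
move=> polK a0; have [[s KE] KT] := polK.
have Ks (i : 'I_(size s)) : K s`_i.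
  by rewrite KE; apply: sub_conv_hull; apply: mem_nth.
have max_support q : q != 0 -> exists x, [/\ K x,
    forall y, K y -> dotv q y <= dotv q x
    & supporting_hyperplane K (level_set q (dotv q x))].
  move=> q0.
  have [j qj] : exists j : 'I_(size s), 0 < dotv q (s`_j - centroid s).
    by apply: centroid_interior => //; rewrite -KE.
  case: (@Order.TotalTheory.arg_maxP _ _ _ j predT (fun i => dotv q s`_i) isT).
  move=> i _ imax; have Kmax y : K y -> dotv q y <= dotv q s`_i.
    by rewrite KE; apply: conv_hull_le => _ /seq_nthP[k <-]; apply: imax.
  exists s`_i; split=> //; exists q, (dotv q s`_i); split=> //.
  by exists s`_i; split.
have [x [Kx maxx suppx]] := max_support a a0.
have [|y [Ky maxy suppy]] := max_support (- a); first by rewrite oppr_eq0.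
exists x, y; split=> //; last by rewrite -level_setN -dotvNl.
rewrite ltNge; apply/negP => xy.
apply: (not_sub_level_set (b := dotv a x) KT a0) => z Kz; apply/le_anti.
rewrite maxx //=; apply: le_trans xy _.
by have := maxy z Kz; rewrite !dotvNl lerN2.
Qed.

Lemma width_le K a b c : convex_polytope K -> a != 0 ->
  (forall x, K x -> b <= dotv a x <= c) -> width K <= (c - b) / enorm a.
Proof.
move=> polK a0 Kbc.
have [x [y [Kx Ky yx suppx suppy]]] := parallel_support polK a0.
have dist_le : dist_sets (level_set a (dotv a x)) (level_set a (dotv a y)) <=
    (dotv a x - dotv a y) / enorm a.
  have aa := dotvv_gt0 a0.
  (* The point [x - k *: a] is the foot of the perpendicular from [x] to the opposite supporting
     hyperplane. *)
  pose k := (dotv a x - dotv a y) / dotv a a.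
  apply: le_trans (@dist_sets_le _ _ x (x - k *: a) _ _) _; first by [].
    by rewrite /level_set /= dotvBr dotvZr divfK ?gt_eqF // subKr.
  rewrite subKr enormZ ger0_norm ?divr_ge0 ?dotvv_ge0 ?subr_ge0 ?(ltW yx) //.
  rewrite /k -mulrA ler_wpM2l ?subr_ge0 ?(ltW yx) //.
  rewrite -enorm_sqr expr2 invfM -mulrA mulVf ?mulr1 //.
  by rewrite gt_eqF // enorm_gt0.
apply: le_trans (le_trans dist_le _).
  apply: ge_inf.
    by exists 0 => _ [H1 [H2 [_ _ _ _ ->]]]; apply: dist_sets_ge0.
  exists (level_set a (dotv a x)), (level_set a (dotv a y)); split=> //.
    move=> lxy; have : level_set a (dotv a x) x by [].
    by rewrite lxy /level_set /= => xy; rewrite xy ltxx in yx.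
  by exists a, (dotv a x), (dotv a y).
rewrite ler_wpM2r ?invr_ge0 ?enorm_ge0 // lerB //.
  by have /andP[] := Kbc x Kx.
by have /andP[] := Kbc y Ky.
Qed.

(** The component of [a'] orthogonal to [a] is a direction inside the common hyperplane, so [a']
    annihilates it and it vanishes. *)
Lemma level_set_inj a a' (b b' : R) :
    a != 0 -> level_set a b = level_set a' b' ->
  exists k, a' = k *: a /\ b' = k * b.
Proof.
move=> a0 lE; have aa : dotv a a != 0 by rewrite dotvv_eq0.
pose x := (b / dotv a a) *: a; pose k := dotv a a' / dotv a a.
have ax : dotv a x = b by rewrite dotvZr divfK.
have a'x : dotv a' x = b' by have : level_set a b x := ax; rewrite lE.
have aq : dotv a (a' - k *: a) = 0 by rewrite dotvBr dotvZr divfK // subrr.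
have a'q : dotv a' (a' - k *: a) = 0.
  have : level_set a b (x + (a' - k *: a)).
    by rewrite /level_set /= dotvDr ax aq addr0.
  by rewrite lE /level_set /= (dotvDr _ x) a'x; lra.
have a'E : a' = k *: a.
  apply/eqP; rewrite -subr_eq0 -dotvv_eq0 {1}dotvBl dotvZl a'q aq.
  by rewrite mulr0 subrr.
by exists k; split=> //; rewrite -a'x a'E dotvZl ax.
Qed.

Lemma eball_support K c r a b : 0 <= r -> eball c r `<=` K -> a != 0 ->
  (forall x, K x -> dotv a x <= b) -> dotv a c + r * enorm a <= b.
Proof.
move=> r_ge0 ballK a0 Kab; have na := enorm_gt0 a0.
have /ballK/Kab : eball c r (c + (r / enorm a) *: a).
  rewrite /eball /= addrC addKr enormZ ger0_norm ?divr_ge0 ?enorm_ge0 //.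
  by rewrite divfK // gt_eqF.
rewrite dotvDr dotvZr -enorm_sqr expr2 mulrA divfK // gt_eqF //.
Qed.

(** Distinct parallel supporting hyperplanes have opposite outer normals, so they bound a strip
    containing [K] and the ball. That such a pair exists must be shown too, since the infimum of the
    empty set is 0. *)
Lemma eball_width K c r : (0 < d)%N -> convex_polytope K -> 0 <= r ->
  eball c r `<=` K -> 2 * r <= width K.
Proof.
move=> d_gt0 polK r_ge0 ballK; apply: lb_le_inf.
  have [a a0] := @exists_nonzero_vector R _ d_gt0.
  have [x [y [_ _ yx suppx suppy]]] := parallel_support polK a0.
  exists (dist_sets (level_set a (dotv a x)) (level_set a (dotv a y))).
  exists (level_set a (dotv a x)), (level_set a (dotv a y)); split=> //.
    move=> lxy; have : level_set a (dotv a x) x by [].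
    by rewrite lxy /level_set /= => xy; rewrite xy ltxx in yx.
  by exists a, (dotv a x), (dotv a y).
move=> w0 [H1 [H2 [[a1 [b1 [a1_0 -> Kab1 [y1 [Ky1 ay1]]]]]
  [a2 [b2 [a2_0 -> Kab2 [y2 [Ky2 ay2]]]]] neq12 [a [c1 [c2 [a0 E1 E2]]]] ->]]].
have [k1 [a1E b1E]] := level_set_inj a0 (esym E1).
have [k2 [a2E b2E]] := level_set_inj a0 (esym E2).
have k1_0 : k1 != 0 by apply: contra_neq a1_0 => k0; rewrite a1E k0 scale0r.
have k2_0 : k2 != 0 by apply: contra_neq a2_0 => k0; rewrite a2E k0 scale0r.
have [m m0 [a2Em b2Em]] :
  exists2 m, m != 0 & a2 = m *: a1 /\ b2 = m * (k1 * c2).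
  exists (k2 / k1); first by rewrite mulf_neq0 ?invr_eq0.
  by rewrite a1E scalerA mulrA divfK.
move: (k1 * c2) b2Em => b2' b2Em {E1 E2 k1 k2 a1E a2E b1E b2E k1_0 k2_0 a0}.
have na1 := enorm_gt0 a1_0.
have ball1 := eball_support r_ge0 ballK a1_0 Kab1.
have ball2 := eball_support r_ge0 ballK a2_0 Kab2.
rewrite /level_set /= in ay1 ay2.
(* With a positive ratio [m] of the outer normals, both hyperplanes would support [K] on the same
   side, hence coincide. *)
have m_lt0 : m < 0.
  rewrite lt_neqAle m0 leNgt; apply/negP => m_gt0; apply: neq12.
  have lm : level_set a2 b2 = level_set a1 b2'.
    rewrite a2Em b2Em; apply/seteqP; split=> x; rewrite /level_set /= dotvZl.
      by apply/mulfI.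
    by move=> ->.
  rewrite lm; congr level_set; apply/le_anti/andP; split.
    rewrite -ay1 -(ler_pM2l m_gt0) -dotvZl -a2Em -b2Em; exact: Kab2.
  apply: le_trans (Kab1 _ Ky2); move: ay2.
  by rewrite a2Em b2Em dotvZl => /mulfI->.
have gap : 2 * r * enorm a1 <= b1 - b2'.
  move: ball2; rewrite a2Em b2Em dotvZl enormZ ltr0_norm // => ball2.
  suff : b2' <= dotv a1 c - r * enorm a1 by move: ball1; lra.
  by rewrite -(ler_nM2l m_lt0); move: ball2; lra.
apply: lb_le_inf; first by exists (enorm (y1 - y2)), y1 => //; exists y2.
move=> _ [x1 ax1 [x2 ax2 <-]]; rewrite -(ler_pM2r na1); apply: le_trans gap _.
rewrite mulrC; apply: le_trans (dotv_le_enorm _ _); rewrite dotvBr.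
rewrite /level_set /= in ax1 ax2; rewrite ax1.
by move: ax2; rewrite a2Em b2Em dotvZl => /(mulfI m0) ->.
Qed.

(** A crude estimate, which bounds the set of inscribed radii as the supremum in [inradius]
    requires. *)
Lemma eball_diameter K c r : (0 < d)%N -> convex_polytope K -> 0 <= r ->
  eball c r `<=` K -> r <= diameter K.
Proof.
move=> d_gt0 polK r_ge0 ballK.
pose e : 'rV[R]_d := delta_mx 0 (Ordinal d_gt0).
have -> : r = enorm (c + r *: e - c).
  by rewrite addrC addKr enormZ enorm_delta mulr1 ger0_norm.
apply: enorm_le_diameter => //; apply: ballK; rewrite /eball /=.
  by rewrite addrC addKr enormZ enorm_delta mulr1 ger0_norm.
by rewrite subrr enorm0.
Qed.

Lemma eball_inradius K c r : (0 < d)%N -> convex_polytope K -> 0 < r ->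
  eball c r `<=` K -> r <= inradius K.
Proof.
move=> d_gt0 polK r_gt0 ballK; apply: ub_le_sup; last by split=> //; exists c.
exists (diameter K) => r' [r'_gt0 [c' ballK']].
exact: eball_diameter (ltW r'_gt0) ballK'.
Qed.

End Sizes.

(** * Distances from vertices to facets *)

Section FacetDistances.
Context {R : realType} {d : nat}.
Implicit Types (A B K f g H : set 'rV[R]_d) (x y v a q u : 'rV[R]_d).
Implicit Types (s : seq 'rV[R]_d).

Lemma vertices_sub K v : vertices K v -> K v.
Proof.
by move=> [[H [_ vE]] _]; have : [set v] v by []; rewrite vE => -[].
Qed.

(* The reflection [2 u - v] of [v] through [u] violates a constraint which is
   tight only at [u], so some facet through [u] is violated there too. *)
Lemma separating_facet K u v : (0 < d)%N -> convex_polytope K ->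
  vertices K u -> vertices K v -> u <> v ->
  exists f, [/\ facets K f, f u & ~ f v].
Proof.
move=> d_gt0 polK Vu Vv uv; have [s [_ KE VE]] := polytope_vertices d_gt0 polK.
have us : [set` s] u by rewrite -VE.
have [[_ [[a [b [a0 -> Kab _]]] uE]] _] := Vu.
have [Ku au] : (K `&` level_set a b) u by rewrite -uE.
have av : dotv a v < b.
  rewrite lt_neqAle Kab ?andbT; last exact: vertices_sub.
  apply/eqP => av; apply: uv; suff : [set u] v by [].
  by rewrite uE; split=> //; apply: vertices_sub.
rewrite /level_set /= in au.
have [y ys||a' [b' [[_ _ fK _] b'x tight]]] :=
  @facet_beyond _ _ K s a b (2 *: u - v) (proj2 polK) KE.
- by apply: Kab; rewrite KE; apply: sub_conv_hull.
- by rewrite dotvBr dotvZr au; lra.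
exists (K `&` level_set a' b'); split=> //.
  by split=> //; apply: tight.
move=> [_]; rewrite /level_set /= => a'v.
by move: b'x; rewrite dotvBr dotvZr (tight u) // a'v; lra.
Qed.

Lemma hstar_le_facet_dist K f v : facets K f -> vertices K v -> ~ f v ->
  hstar K <= facet_dist f v.
Proof.
move=> Ff Vv fv; apply: ge_inf; last by exists f, v.
exists 0 => _ [g [w [_ _ _ ->]]].
by apply: inf_nonneg => _ [x _ <-]; apply: enorm_ge0.
Qed.

(** Some facet contains [u] and misses [v], and the distance from [v] to its hyperplane is at most
    the distance to [u]. *)
Lemma hstar_le_vertex_dist K u v : (0 < d)%N -> convex_polytope K ->
  vertices K u -> vertices K v -> u <> v -> hstar K <= enorm (u - v).
Proof.
move=> d_gt0 polK Vu Vv uv.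
have [f [Ff fu fv]] := separating_facet d_gt0 polK Vu Vv uv.
apply: le_trans (hstar_le_facet_dist Ff Vv fv) _; rewrite enormB.
by apply: dist_pt_set_le; apply/sub_conv_aff_hull/sub_conv_hull.
Qed.

(** The perpendicular from [v] meets the hyperplane at [v + k *: a], which belongs to the affine
    hull of the facet by the last clause of [facet_normal]. *)
Lemma hstar_le_slack K a b v : facet_normal K a b -> vertices K v ->
  dotv a v != b -> hstar K * enorm a <= b - dotv a v.
Proof.
move=> [a0 Kab Ff affL] Vv av.
have slack_ge0 : 0 <= b - dotv a v.
  by rewrite subr_ge0 Kab //; apply: vertices_sub.
have aa := dotvv_gt0 a0; have na := enorm_gt0 a0; rewrite -ler_pdivlMr //.
apply: le_trans (hstar_le_facet_dist Ff Vv _) _.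
  by move=> [_]; rewrite /level_set /= => /eqP; rewrite (negPf av).
pose k := (b - dotv a v) / dotv a a.
apply: le_trans (dist_pt_set_le v (y := v + k *: a) _) _.
  apply: affL; rewrite /level_set /= dotvDr dotvZr divfK ?gt_eqF //.
  by rewrite addrC subrK.
rewrite opprD addNKr enormN enormZ ger0_norm ?divr_ge0 ?dotvv_ge0 //.
rewrite /k -enorm_sqr expr2 invfM mulrA divfK // gt_eqF //.
Qed.

(* Each facet misses some vertex, which is then at distance at least [hstar K];
   the other vertices only contribute nonnegative distances to the average. *)
Lemma eball_centroid K s r n : convex_polytope K -> K = conv_hull [set` s] ->
  vertices K = [set` s] -> (size s <= n)%N -> 0 <= r -> r * n%:R <= hstar K ->
  eball (centroid s) r `<=` K.
Proof.
move=> polK KE VE sn r_ge0 rh x xr; apply: contrapT.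
(* A point [x] of the ball outside [K] would violate a facet inequality. *)
rewrite {1}KE => /conv_hull_separation[a0 [b0 [sab0 b0x]]].
have [a [b [abK bx _]]] := facet_beyond (proj2 polK) KE sab0 b0x.
have [a_neq0 Kab _ _] := abK; have na := enorm_gt0 a_neq0.
have sab (i : 'I_(size s)) : dotv a s`_i <= b.
  by apply: Kab; rewrite KE; apply: sub_conv_hull; apply: mem_nth.
have sT : aff_hull (conv_hull [set` s]) = setT by rewrite -KE; case: polK.
have [i ai] : exists i : 'I_(size s), dotv a s`_i != b.
  apply: contrapT => tight.
  apply: (conv_hull_not_sub_level_set (b := b) sT a_neq0).
  move=> _ /seq_nthP[j <-]; apply: contrapT => aj; apply: tight.
  by exists j; apply/eqP.
have slack : hstar K * enorm a <= (size s)%:R * (b - dotv a (centroid s)).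
  have -> : (size s)%:R * (b - dotv a (centroid s)) =
      \sum_(j < size s) (b - dotv a s`_j).
    transitivity (\sum_(j < size s)
        (b - dotv a (centroid s) - dotv a (s`_j - centroid s))).
      rewrite sumrB -dotv_sumr sum_centroidB dotv0r subr0.
      by rewrite sumr_const card_ord mulr_natl.
    by apply: eq_bigr => j _; rewrite dotvBr; ring.
  rewrite (bigD1 i) //= -[leLHS]addr0; apply: lerD.
    by apply: hstar_le_slack => //; rewrite VE; apply: mem_nth.
  by apply: sumr_ge0 => j _; rewrite subr_ge0.
have ax : dotv a x <= dotv a (centroid s) + r * enorm a.
  rewrite -lerBlDl -dotvBr; apply: le_trans (dotv_le_enorm _ _) _.
  by rewrite mulrC ler_wpM2r ?enorm_ge0.
have s_gt0 : 0 < (size s)%:R :> R.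
  by rewrite ltr0n (leq_ltn_trans _ (ltn_ord i)).
have sr :
    (size s)%:R * (r * enorm a) <= (size s)%:R * (b - dotv a (centroid s)).
  apply: le_trans slack; rewrite mulrA ler_wpM2r ?enorm_ge0 //.
  apply: le_trans rh; rewrite mulrC ler_wpM2l // ler_nat //.
by move: sr; rewrite ler_pM2l //; lra.
Qed.

End FacetDistances.

(** * The width bounded by the inradius, through a simplex of maximal volume *)

Section Simplex.
Context {R : realType} {d : nat}.
Implicit Types (K : set 'rV[R]_d) (x c a : 'rV[R]_d) (s : seq 'rV[R]_d).
Implicit Types (Y : 'M[R]_d).

(** The cofactors in the expansion along row [j] do not involve the replaced row, so they are
    entries of the adjugate of [Y]. *)
Lemma cramer_row Y x j : Y \in unitmx ->
  (x *m invmx Y) 0 j * \det Y =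
  \det (\matrix_i (if i == j then x else row i Y)).
Proof.
move=> Yu; have detY : \det Y != 0 by rewrite -unitfE -unitmxE.
rewrite [RHS](expand_det_row _ j) /invmx Yu -scalemxAr [X in X * _]mxE.
rewrite [LHS]mulrAC mulVf // mul1r mxE; apply: eq_bigr => k _.
rewrite !mxE eqxx; congr (_ * (_ * \det _)); apply/matrixP => i l; rewrite !mxE.
by rewrite eq_sym (negPf (neq_lift _ _)) mxE.
Qed.

(* A simplex of maximal volume with one vertex fixed: by Cramer's rule, all
   points of [K] have coordinates of absolute value at most [1] in it. *)
Lemma max_simplex K s : convex_polytope K -> K = conv_hull [set` s] ->
  exists x0 Y, [/\ Y \in unitmx, x0 \in s, forall i, x0 + row i Y \in s
    & forall x, K x -> forall j, `|((x - x0) *m invmx Y) 0 j| <= 1].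
Proof.
move=> [_ KT] KE; have sT : aff_hull (conv_hull [set` s]) = setT by rewrite -KE.
have [i0 _] : exists i : 'I_(size s), True.
  have /aff_hull_nonempty[z] : aff_hull K 0 by rewrite KT.
  rewrite KE => /sub_conv_aff_hull/aff_hull_nonempty[y /seq_nthP[i _]].
  by exists i.
pose x0 := s`_i0; pose edges (phi : {ffun 'I_d -> 'I_(size s)}) : 'M[R]_d :=
  \matrix_i (s`_(phi i) - x0).
have [phi0 phi0u] : exists phi, edges phi \in unitmx.
  (* The differences of the generators with [x0] span the space, so [d] independent ones can be
     selected. *)
  pose X : 'M[R]_(size s, d) := \matrix_i (s`_i - x0).
  have Xfull : row_full X.
    apply: contrapT => /negP/not_row_full_orthogonal[q q0 Xq].
    apply: (conv_hull_not_sub_level_set (b := dotv q x0) sT q0).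
    move=> _ /seq_nthP[i <-].
    by apply/eqP; rewrite -subr_eq0 -dotvBr -(rowK (fun i => s`_i - x0)) Xq.
  exists (fullrankfun Xfull); suff -> : edges (fullrankfun Xfull) =
    rowsub (fullrankfun Xfull) X by apply: fullrowsub_unit.
  by apply/matrixP => i j; rewrite !mxE.
case: (@Order.TotalTheory.arg_maxP
         _ _ _ phi0 predT (fun phi => `|\det (edges phi)|) isT).
move=> phi _ max_phi.
have detY : 0 < `|\det (edges phi)|.
  apply: lt_le_trans (max_phi phi0 isT).
  by rewrite normr_gt0 -unitfE -unitmxE.
have Yu : edges phi \in unitmx by rewrite unitmxE unitfE -normr_gt0.
exists x0, (edges phi); split=> //; first exact: mem_nth.
  by move=> i; rewrite rowK addrC subrK mem_nth.
have coordE x j : ((x - x0) *m invmx (edges phi)) 0 j =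
    dotv (row j (invmx (edges phi))^T) x
    - dotv (row j (invmx (edges phi))^T) x0.
  by rewrite -dotvBr mxE dotvC; apply: eq_bigr => k _; rewrite !mxE.
have s_le y : y \in s -> forall j, `|((y - x0) *m invmx (edges phi)) 0 j| <= 1.
  move=> /seq_nthP[k <-] j.
  rewrite -(ler_pM2r detY) -normrM cramer_row // mul1r.
  (* Exchanging one vertex of the simplex for another generator cannot increase the volume. *)
  have := max_phi [ffun i => if i == j then k else phi i] isT.
  rewrite /=; congr (`|\det _| <= _); apply/row_matrixP => i.
  by rewrite !rowK ffunE; case: ifP => _; rewrite ?rowK.
(* The coordinates are affine in [x], so the bounds pass from the generators to their hull. *)
move=> x; rewrite KE => sx j; rewrite coordE ler_norml; apply/andP; split.
  rewrite lerBrDr -lerN2 opprD opprK -dotvNl.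
  apply: conv_hull_le sx => y /= ys; have := s_le y ys j.
  by rewrite coordE ler_norml dotvNl => /andP[]; lra.
rewrite lerBlDr; apply: conv_hull_le sx => y /= ys; have := s_le y ys j.
by rewrite coordE ler_norml => /andP[]; lra.
Qed.

(** At the centroid of the simplex all coordinates along the rows of [Y] are [1 / (d + 1)]. Within
    the ball each changes by at most [1 / (d (d + 1))], so it lies between 0 and [1 / d], and the
    [d] coordinates sum to at most 1. *)
Lemma eball_simplex s x0 Y A : (0 < d)%N -> Y \in unitmx -> x0 \in s ->
  (forall i, x0 + row i Y \in s) -> 0 < A ->
  (forall j, enorm (row j (invmx Y)^T) <= A) ->
  exists c, eball c (A * (d * d.+1)%:R)^-1 `<=` conv_hull [set` s].
Proof.
move=> d_gt0 Yu x0s Ys A_gt0 nY.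
pose t0 : 'rV[R]_d := const_mx d.+1%:R^-1; exists (x0 + t0 *m Y) => x xc.
pose t := (x - x0) *m invmx Y.
have dR : 0 < d%:R :> R by rewrite ltr0n.
have tE j : t 0 j = d.+1%:R^-1 + dotv (row j (invmx Y)^T) (x - (x0 + t0 *m Y)).
  have -> : t = t0 + (x - (x0 + t0 *m Y)) *m invmx Y.
    by rewrite opprD addrA mulmxBl mulmxK // addrCA subrr addr0.
  rewrite mxE mxE; congr (_ + _).
  by rewrite mxE dotvC; apply: eq_bigr => k _; rewrite !mxE.
set e1 : R := d.+1%:R^-1; set e2 : R := (d * d.+1)%:R^-1.
have t_near j : e1 - e2 <= t 0 j <= e1 + e2.
  have le1 v w : enorm v <= A -> enorm w <= (A * (d * d.+1)%:R)^-1 ->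
      dotv v w <= e2.
    move=> vA wA; apply: le_trans (dotv_le_enorm _ _) _.
    apply: le_trans (ler_pM (enorm_ge0 _) (enorm_ge0 _) vA wA) _.
    by rewrite invfM mulrA divff ?mul1r // gt_eqF.
  by rewrite tE !lerD2l lerNl -dotvNr !le1 ?enormN.
have t_ge0 j : 0 <= t 0 j.
  have [/andP[t_ge _] e21] : (e1 - e2 <= t 0 j <= e1 + e2) /\ e2 <= e1.
    rewrite t_near lef_pV2 ?posrE ?ltr0n ?muln_gt0 ?d_gt0 //.
    by rewrite ler_nat leq_pmull.
  by apply: le_trans t_ge; rewrite subr_ge0.
have t_sum : \sum_j t 0 j <= 1.
  apply: (@le_trans _ _ (\sum_(j < d) (e1 + e2))).
    by apply: ler_sum => j _; case/andP: (t_near j).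
  rewrite sumr_const card_ord -mulr_natl /e1 /e2 natrM.
  by rewrite le_eqVlt; apply/orP; left; apply/eqP; field;
    rewrite (gt_eqF dR) andbT gt_eqF // addr_gt0.
exists d.+1, (fun i => if unlift ord0 i is Some j then x0 + row j Y else x0).
exists (fun i => if unlift ord0 i is Some j then t 0 j else 1 - \sum_j t 0 j).
split.
- by move=> i; case: unliftP => [j|] _ /=; first exact: Ys.
- by move=> i; case: unliftP => [j|] _; rewrite ?subr_ge0.
- rewrite big_ord_recl unlift_none [X in _ + X = _](eq_bigr (t 0)) ?subrK //.
  by move=> j _; rewrite liftK.
rewrite big_ord_recl unlift_none.
rewrite [X in _ = _ + X](eq_bigr (fun j => t 0 j *: x0 + t 0 j *: row j Y)).
  rewrite big_split /= -scaler_suml addrA -scalerDl subrK scale1r.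
  by rewrite -mulmx_sum_row mulmxKV // addrC subrK.
by move=> j _; rewrite liftK scalerDr.
Qed.

Lemma width_le_inradius K : (0 < d)%N -> convex_polytope K ->
  0 < inradius K /\ width K <= (2 * (d * d.+1))%:R * inradius K.
Proof.
move=> d_gt0 polK; have [[s KE] _] := polK.
have [x0 [Y [Yu x0s Ys coordK]]] := max_simplex polK KE.
have dd : 0 < (d * d.+1)%:R :> R by rewrite ltr0n muln_gt0 d_gt0.
have ball A : 0 < A -> (forall j, enorm (row j (invmx Y)^T) <= A) ->
    0 < (A * (d * d.+1)%:R)^-1 /\
    exists c, eball c (A * (d * d.+1)%:R)^-1 `<=` K.
  move=> A_gt0 nA; split; first by rewrite invr_gt0 mulr_gt0.
  by rewrite KE; apply: eball_simplex Ys A_gt0 nA.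
(* A first ball, from a crude bound on the gradients, shows that [width K] is positive before it
   serves as a divisor. *)
have [r [r_gt0 [c ballK]]] : exists r, 0 < r /\ exists c, eball c r `<=` K.
  pose A := 1 + \sum_j enorm (row j (invmx Y)^T).
  have nsum_ge0 (P : pred 'I_d) : 0 <= \sum_(j | P j) enorm (row j (invmx Y)^T).
    by apply: sumr_ge0 => j _; apply: enorm_ge0.
  have [||r_gt0 ballr] := ball A; last by exists (A * (d * d.+1)%:R)^-1.
    by rewrite ltr_pwDl.
  move=> j; rewrite /A (bigD1 j) //=.
  by have := nsum_ge0 (predC1 j); move: (enorm _) => e; rewrite /=; lra.
have rho_gt0 : 0 < inradius K.
  by apply: lt_le_trans (eball_inradius _ _ _ ballK).
have w_gt0 : 0 < width K.
  apply: lt_le_trans (eball_width d_gt0 polK (ltW r_gt0) ballK).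
  by rewrite mulr_gt0.
split=> //; have [||r'_gt0 [c' ballK']] := ball (2 / width K).
- by rewrite divr_gt0.
- move=> j; set a := row j _.
  have a0 : a != 0.
    have : (Y *m invmx Y) j j = dotv (row j Y) a.
      by rewrite mxE; apply: eq_bigr => k _; rewrite !mxE.
    rewrite mulmxV // mxE eqxx => aY; apply: contra_eq_neq aY => ->.
    by rewrite dotv0r oner_neq0.
  (* Coordinate [j] has gradient [a] and varies on [K] within 1 of its value at [x0], so [K] lies in
     a strip of thickness [2 / enorm a]. *)
  have := @width_le _ _ K a (dotv a x0 - 1) (dotv a x0 + 1) polK a0.
  have -> : dotv a x0 + 1 - (dotv a x0 - 1) = 2 by ring.
  move=> w_le; rewrite ler_pdivlMr // mulrC -ler_pdivlMr ?enorm_gt0 //.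
  apply: w_le => x Kx; have := coordK x Kx j.
  have -> : ((x - x0) *m invmx Y) 0 j = dotv a x - dotv a x0.
    by rewrite -dotvBr mxE dotvC; apply: eq_bigr => k _; rewrite !mxE.
  by rewrite ler_norml; lra.
have r'_le := eball_inradius d_gt0 polK r'_gt0 ballK'.
apply: le_trans (ler_wpM2l (ler0n _ _) r'_le); rewrite natrM invfM invf_div.
move: (_%:R) dd => D D_gt0; rewrite le_eqVlt; apply/orP; left; apply/eqP.
by field; rewrite gt_eqF.
Qed.

End Simplex.

(** * Cardinality bounds from injections *)

Section Counting.

Lemma card_le_II_inj T (A : set T) n : A #<= `I_n ->
  exists g : T -> nat, (forall x, A x -> (g x < n)%N) /\
    (forall x y, A x -> A y -> g x = g y -> x = y).
Proof.
move=> /pcard_leP[g]; exists g; split=> [x Ax|x y Ax Ay].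
  exact: (@funS _ _ _ _ g x Ax).
by apply: (@inj _ _ _ g); apply: mem_set.
Qed.

Lemma inj_card_le_II T (I : finType) (A : set T) (g : T -> I) :
  (forall x y, A x -> A y -> g x = g y -> x = y) -> A #<= `I_#|I|.
Proof.
move=> g_inj; pose h x : nat := enum_rank (g x).
have hA : h @` A #= A.
  apply: inj_card_eq => x y; rewrite !inE => Ax Ay /ord_inj/enum_rank_inj.
  exact: g_inj.
rewrite -(card_le_eql hA); apply: subset_card_le => _ [x _ <-] /=.
exact: ltn_ord.
Qed.

(** Each [u] is encoded by the set of the numbers of those elements of [A] that are incident with
    it, a subset of ['I_n]. *)
Lemma card_le_incidence T U (A : set T) (B : set U) (P : T -> U -> Prop) n :
    A #<= `I_n ->
    (forall u u', B u -> B u' ->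
      (forall a, A a -> P a u <-> P a u') -> u = u') ->
  B #<= `I_(2 ^ n).
Proof.
move=> /card_le_II_inj[g [g_lt g_inj]] P_inj.
pose h u := [set i : 'I_n | `[< exists a, [/\ A a, P a u & g a = i] >]]%SET.
have -> : (2 ^ n)%N = #|{set 'I_n}|.
  by rewrite -cardsT -powersetT card_powerset cardsT card_ord.
apply: (@inj_card_le_II _ _ _ h) => u u' Bu Bu' /setP huu'.
apply: P_inj => // a Aa.
have hP w : (Ordinal (g_lt a Aa) \in h w) <-> P a w.
  rewrite inE; split=> [/asboolP[a' [Aa' Pa' /g_inj <-//]]|Paw].
  by apply/asboolP; exists a.
by rewrite -!hP huu'.
Qed.

End Counting.

(** * Numbers of vertices and facets, and the width against [hstar] *)

Section Families.
Context {R : realType} {d : nat}.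
Implicit Types (K f g : set 'rV[R]_d) (u v : 'rV[R]_d) (s : seq 'rV[R]_d).

(** A point of [f] is a convex combination of vertices on [f]; these satisfy the equation of the
    hyperplane that cuts out [g], hence so does the point. *)
Lemma face_sub_vertices K f g :
    (0 < d)%N -> convex_polytope K -> face K f -> face K g ->
  (forall v, vertices K v -> f v -> g v) -> f `<=` g.
Proof.
move=> d_gt0 polK [_ [[a [b [_ -> Kab _]]] ->]].
move=> [_ [[a' [b' [_ -> _ _]]] ->]] fg.
have [s [_ KE VE]] := polytope_vertices d_gt0 polK.
have sK y : [set` s] y -> K y by rewrite KE; apply: sub_conv_hull.
move=> x [Kx ax]; split=> //.
have : (conv_hull [set` s] `&` level_set a b) x by rewrite -KE.
have sab y : [set` s] y -> dotv a y <= b by move=> /sK; apply: Kab.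
move=> /(conv_hull_face sab)[n [p [w [ps _ w1 ->]]]].
apply: (@aff_hull_level_set _ _ ([set` s] `&` level_set a b)); last first.
  by exists n, p, w.
move=> y [sy ay]; have [] // : (K `&` level_set a' b') y.
by apply: fg; [rewrite VE | split=> //; apply: sK].
Qed.

Lemma card_facets_le K n :
    (0 < d)%N -> convex_polytope K -> vertices K #<= `I_n ->
  facets K #<= `I_(2 ^ n).
Proof.
move=> d_gt0 polK Vn; apply: (card_le_incidence (P := fun v f => f v) Vn).
move=> f g [Kf _] [Kg _] fg; apply/seteqP; split.
  by apply: (face_sub_vertices d_gt0 polK) => // v Vv /fg; apply.
by apply: (face_sub_vertices d_gt0 polK) => // v Vv /fg; apply.
Qed.

Lemma card_vertices_le K n :
    (0 < d)%N -> convex_polytope K -> facets K #<= `I_n ->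
  vertices K #<= `I_(2 ^ n).
Proof.
move=> d_gt0 polK Fn; apply: (card_le_incidence (P := fun f v => f v) Fn).
move=> u v Vu Vv uv; apply: contrapT => neq_uv.
have [f [Ff fu fv]] := separating_facet d_gt0 polK Vu Vv neq_uv.
by apply: fv; apply/(uv f Ff).
Qed.

(* Two distinct vertices cannot lie in the same cell of a cubic grid whose
   cells have sides [diameter K / m] with [m > d / D]. *)
Lemma card_vertices_packing (D : R) : 0 < D ->
  exists n, forall K, convex_polytope K ->
    (forall u v, vertices K u -> vertices K v -> u <> v ->
      D * diameter K <= enorm (u - v)) ->
    vertices K #<= `I_n.
Proof.
move=> D_gt0; pose m := (Num.truncn (d%:R / D)).+1.
have dm : d%:R < m%:R * D.
  by rewrite -ltr_pdivrMr // truncnS_gt.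
exists #|{ffun 'I_d -> 'I_(2 * m).+1}| => K polK sepK.
have [x0 Kx0] := convex_polytope_nonempty polK; set h := diameter K.
(* The coordinates relative to [x0] lie in [[-h, h]], and [z] maps them to [[0, 2 m]]; the endpoint
   accounts for the extra value in ['I_(2 * m).+1]. *)
pose z v i := ((v - x0) 0 i / h + 1) * m%:R.
pose cell v : {ffun 'I_d -> 'I_(2 * m).+1} :=
  [ffun i => inord (Num.truncn (z v i))].
apply: (@inj_card_le_II _ _ _ cell) => u v Vu Vv /ffunP cuv.
apply: contrapT => neq_uv.
have [Ku Kv] := (vertices_sub Vu, vertices_sub Vv).
have h_gt0 : 0 < h.
  apply: lt_le_trans (enorm_le_diameter polK Ku Kv); apply: enorm_gt0.
  by rewrite subr_eq0; apply/eqP.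
have z_bound w i : K w -> 0 <= z w i <= (2 * m)%:R.
  move=> Kw; have : `|(w - x0) 0 i / h| <= 1.
    rewrite normrM normfV (gtr0_norm h_gt0) ler_pdivrMr // mul1r.
    exact: le_trans (coord_le_enorm _ _) (enorm_le_diameter polK Kw Kx0).
  rewrite /z natrM ler_norml; move: (_ / h) => t /andP[t1 t2].
  by rewrite mulr_ge0 ?ler0n ?ler_wpM2r //; lra.
have near i : `|(u - v) 0 i| <= h / m%:R.
  have m_gt0 : 0 < m%:R :> R by rewrite ltr0n.
  have /andP[zu_ge0 zu_le] := z_bound u i Ku.
  have /andP[zv_ge0 zv_le] := z_bound v i Kv.
  have cellE w : K w -> nat_of_ord (cell w i) = Num.truncn (z w i).
    move=> Kw; rewrite ffunE inordK // ltnS.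
    have /andP[z_ge0 z_le] := z_bound w i Kw.
    by rewrite -(ler_nat R); apply: le_trans z_le; rewrite truncn_le.
  have tuv : Num.truncn (z u i) = Num.truncn (z v i) by rewrite -!cellE // cuv.
  have /andP[u1 u2] := truncn_itv zu_ge0.
  have /andP[v1 v2] := truncn_itv zv_ge0.
  rewrite tuv in u1 u2.
  have -> : (u - v) 0 i = (z u i - z v i) * (h / m%:R).
    by rewrite /z !mxE; field; rewrite ?gt_eqF.
  rewrite normrM [X in _ * X]ger0_norm ?divr_ge0 ?(ltW h_gt0) ?ler0n //.
  rewrite ler_piMl ?divr_ge0 ?(ltW h_gt0) ?ler0n // ler_norml.
  by move: u1 u2 v1 v2; rewrite -natr1; lra.
(* Adding [d] coordinate differences of at most [h / m] bounds the distance of the two vertices,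
   which contradicts [dm]. *)
have : D * h <= d%:R * (h / m%:R).
  apply: le_trans (sepK u v Vu Vv neq_uv) _; apply: le_trans (enorm_le_sum _) _.
  apply: (@le_trans _ _ (\sum_(i < d) h / m%:R)); first exact: ler_sum.
  by rewrite sumr_const card_ord mulr_natl.
by rewrite (mulrC D) mulrCA ler_pM2l // ler_pdivlMr ?ltr0n // mulrC leNgt dm.
Qed.

(** The ball of radius [C / n * diameter K] about the centroid of the vertices is inscribed, and
    twice its radius is a lower bound for the width. *)
Lemma hstar_width K n (C : R) :
    (0 < d)%N -> convex_polytope K -> 0 < C -> (0 < n)%N ->
    vertices K #<= `I_n -> C * diameter K <= hstar K ->
  2 * (C / n%:R) * diameter K <= width K.
Proof.
move=> d_gt0 polK C_gt0 n_gt0 Vn Ch.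
have [s [uniq_s KE VE]] := polytope_vertices d_gt0 polK.
have sn : (size s <= n)%N.
  have [g [g_lt g_inj]] := card_le_II_inj Vn; rewrite VE in g_lt g_inj.
  rewrite -(size_map g) -(size_iota 0 n); apply: uniq_leq_size.
    by rewrite map_inj_in_uniq // => x y xs ys; apply: g_inj.
  by move=> _ /mapP[x xs ->]; rewrite mem_iota g_lt.
have r_ge0 : 0 <= C / n%:R * diameter K.
  by rewrite mulr_ge0 ?divr_ge0 ?ler0n ?diameter_ge0 // ltW.
rewrite -mulrA; apply: eball_width => //.
apply: eball_centroid VE sn r_ge0 _ => //.
by rewrite mulrAC divfK // pnatr_eq0 -lt0n.
Qed.

End Families.

(** * The implications, with constants uniform over the family *)

Theorem lemma4p2 (R : realType) (d : nat) (calK : set (set 'rV[R]_d)) :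
  (1 <= d)%N ->
  (forall K, calK K ->
    [/\ convex_polytope K, nondegenerate_polytope K & simple_polytope K]) ->
  [/\ condH1 calK -> condH2 calK,
      condH2 calK -> condH3 calK,
      condH3 calK <-> condH4 calK,
      condH1 calK -> condH5 calK
    & condH5 calK <-> condH5' calK].
Proof.
move=> d_gt0 calK_pol.
have pol K : calK K -> convex_polytope K by move=> /calK_pol[].
have H12 : condH1 calK -> condH2 calK.
  move=> [C [C_gt0 HC]]; exists C; split=> // K KK u v Vu Vv uv.
  by apply: le_trans (HC K KK) _; apply: hstar_le_vertex_dist => //; apply: pol.
have H23 : condH2 calK -> condH3 calK.
  move=> [D [D_gt0 HD]]; have [n Hn] := @card_vertices_packing R d D D_gt0.
  (* The successor only makes the bound positive. *)
  exists n.+1; split=> // K KK.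
  apply: card_le_trans (Hn K (pol K KK) (HD K KK)) _.
  by rewrite card_le_II.
split=> //.
- split=> -[n [n_gt0 Hn]]; exists (2 ^ n)%N; rewrite expn_gt0; split=> // K KK.
    by apply: card_facets_le (Hn K KK) => //; apply: pol.
  by apply: card_vertices_le (Hn K KK) => //; apply: pol.
- move=> H1; have [n [n_gt0 Hn]] := H23 (H12 H1); have [C [C_gt0 HC]] := H1.
  exists (2 * (C / n%:R)); split; first by rewrite mulr_gt0 ?divr_gt0 ?ltr0n.
  move=> K KK.
  by apply: hstar_width => //; [apply: pol | apply: Hn | apply: HC].
split=> [[C [C_gt0 HC]]|[gamma [gamma_gt0 Hgamma]]].
  have c_gt0 : 0 < (2 * (d * d.+1))%:R :> R by rewrite ltr0n !muln_gt0 d_gt0.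
  exists ((2 * (d * d.+1))%:R / C); split; first by rewrite divr_gt0.
  move=> K KK; have [rho_gt0 w_le] := width_le_inradius d_gt0 (pol K KK).
  rewrite ler_pdivrMr // mulrAC ler_pdivlMr // mulrC.
  exact: le_trans (HC K KK) w_le.
(* The constant combines [diameter K <= gamma * inradius K] with [2 * inradius K <= width K]. *)
exists (2 / gamma); split; first by rewrite divr_gt0.
move=> K KK; have polK := pol K KK.
have [rho_gt0 _] := width_le_inradius d_gt0 polK.
have rho_le : inradius K <= width K / 2.
  (* The set of radii is nonempty because [inradius K] is positive, whereas the supremum of the
     empty set is 0. *)
  apply: ge_sup.
    apply/set0P/eqP => E0; move: rho_gt0.
    by rewrite /inradius E0 sup0 ltxx.
  move=> r [r_gt0 [c ballK]]; rewrite ler_pdivlMr // mulrC.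
  exact: eball_width (ltW r_gt0) ballK.
have := Hgamma K KK; rewrite ler_pdivrMr // => diam_le.
rewrite mulrAC ler_pdivrMr //.
have := ler_wpM2l (ltW gamma_gt0) rho_le; lra.
Qed.
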